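(* Let $B$ be a commutative Bézout domain. Then given any pp $\mathcal L_{B,V}$-formula $\phi(\mathbf z)$, there exist finitely many constructible subsets $C_{\phi,k}$ of $MSpec(B)$, $k\in K$, $K$ finite, such that for any $\mathcal M\in C_{\phi,k}$, $\phi(\mathbf z)$ is equivalent to a conjunction $\chi_k(\mathbf z)$ of atomic $\mathcal L_{B_{\mathcal M},V}$-formulas, in the classes $Mod_{B_{\mathcal M}}$ of all $B_{\mathcal M}$-modules. In particular, for $\mathcal M\in MSpec(B)$, any pp $\mathcal L_{B,V}$-formula $\phi(z)$ in one variable is equivalent in $Mod_{B_{\mathcal M}}$ to a formula of the form $$z.a=0\ \wedge\ \bigwedge_{i=1}^n V_{\delta_i}(z.b_i),$$ for some $a\in B_{\mathcal M}$, nonzero $b_i\in B_{\mathcal M}$ and $\delta_i\in\Gamma(B_{\mathcal M})^+$, $1\le i\le n$, with $\delta_1\cdot v_{\mathcal M}(b_1)^{-1}>\cdots>\delta_n\cdot v_{\mathcal M}(b_n)^{-1}$ and $v_{\mathcal M}(b_1)>\cdots>v_{\mathcal M}(b_n)$.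
   Context: Rings are commutative integral domains with $1$; $B$ is Bézout if every finitely generated ideal is principal. $Q(B)$ is the fraction field, $U$ the group of units of $B$, and $\Gamma(B)=Q(B)^\times/U$ the group of divisibility (written multiplicatively), ordered by $aU\le bU$ iff $ba^{-1}\in B$; its positive part is $\Gamma(B)^+=\{aU: a\in B\setminus\{0\}\}$, and $v(a)=aU$. $MSpec(B)$ is the set of maximal ideals of $B$; its basic closed sets are $V(a)=\{\mathcal M\in MSpec(B): a\in\mathcal M\}$, $a\in B$, and the constructible subsets are the elements of the Boolean algebra generated by the sets $V(a)$. For $\mathcal M\in MSpec(B)$, $B_{\mathcal M}$ is the localization of $B$ at $\mathcal M$ (a valuation domain), $\Gamma(B_{\mathcal M})$ is its (totally ordered) value group, $v_{\mathcal M}$ its valuation, and $\delta_{\mathcal M}$ is the image in $\Gamma(B_{\mathcal M})$ of $\delta\in\Gamma(B)$. For a Bézout domain $R$, $\mathcal L_R=\{+,-,0,\cdot a: a\in R\}$ is the language of $R$-modules and $\mathcal L_{R,V}=\mathcal L_R\cup\{V_\delta:\delta\in\Gamma(R)^+\}$ with unary predicates $V_\delta$. Every $R$-module $N$ is regarded as an $\mathcal L_{R,V}$-structure by $V_\delta(N)=\{m\in N:\exists n\in N\ m=n.a\}$ where $\delta=v(a)$, $a\in R\setminus\{0\}$. A $B_{\mathcal M}$-module is also an $\mathcal L_{B,V}$-structure (via $B\to B_{\mathcal M}$), and there $V_\delta=V_{\delta_{\mathcal M}}$ for $\delta\in\Gamma(B)^+$. A pp (positive primitive) formula is one of the form $\exists\mathbf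 x\,\theta(\mathbf x,\mathbf z)$ with $\theta$ a conjunction of atomic formulas. That $\chi_k$ is a single conjunction of atomic $\mathcal L_{B_{\mathcal M},V}$-formulas for all $\mathcal M\in C_{\phi,k}$ means: its scalars are elements of $Q(B)$ that lie in $B_{\mathcal M}$ for every $\mathcal M\in C_{\phi,k}$, and its predicates are $V_\delta$ with $\delta\in\Gamma(B)$ such that $\delta_{\mathcal M}\in\Gamma(B_{\mathcal M})^+$ for every $\mathcal M\in C_{\phi,k}$, $V_\delta$ being read as $V_{\delta_{\mathcal M}}$ in $B_{\mathcal M}$-modules. *)

(* Defs.v *)
From HB Require Import structures.
From mathcomp Require Import all_boot all_order all_algebra.
From mathcomp Require Import generic_quotient fraction ring_quotient.
From mathcomp Require Import boolp classical_sets.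

Set Implicit Arguments.
Unset Strict Implicit.
Unset Printing Implicit Defensive.

Import Order.TTheory GRing.Theory.
Local Open Scope ring_scope.
Local Open Scope quotient_scope.

Notation "x %:F" := (@FracField.tofrac _ x) : ring_scope.

Definition ideal_gen (R : idomainType) n (a : 'I_n -> R) : set R :=
  [set x | exists c : 'I_n -> R, x = \sum_(i < n) c i * a i].

Definition principal_ideal (R : idomainType) (d : R) : set R :=
  [set x | exists c : R, x = c * d].

Definition bezout (R : idomainType) : Prop :=
  forall n (a : 'I_n -> R), exists d : R, ideal_gen a = principal_ideal d.

Notation nz R := {x : R | x != 0}.

Section Nonzero.
Variable F : idomainType.

Definition NZ (x : F) (x0 : x != 0) : nz F := exist _ x x0.

Definition nz1 : nz F := NZ (oner_neq0 F).

Lemma nzmul_subproof (x y : nz F) : val x * val y != 0.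
Proof. by rewrite mulf_neq0 ?(valP x) ?(valP y). Qed.
Definition nzmul (x y : nz F) : nz F := NZ (nzmul_subproof x y).

Lemma nzinv_subproof (x : nz F) : (val x)^-1 != 0.
Proof. by rewrite invr_eq0 (valP x). Qed.
Definition nzinv (x : nz F) : nz F := NZ (nzinv_subproof x).

End Nonzero.

Section Divisibility.
Variable R : idomainType.
Local Notation Q := {fraction R}.
Implicit Types x y z : nz Q.

Definition assoc_div x y : bool :=
  `[< exists2 u : R, u \is a GRing.unit & val x = val y * u%:F >].

Lemma assoc_div_refl : reflexive assoc_div.
Proof. by move=> x; apply/asboolP; exists 1; rewrite ?unitr1 ?tofrac1 ?mulr1. Qed.

Lemma tofrac_unitV (u : R) : u \is a GRing.unit -> (u^-1)%:F = (u%:F)^-1.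
Proof. by move=> Uu; rewrite rmorphV. Qed.

Lemma assoc_div_symW x y : assoc_div x y -> assoc_div y x.
Proof.
move=> /asboolP[u Uu e]; apply/asboolP; exists u^-1; first by rewrite unitrV.
by rewrite e -mulrA -tofracM mulrV // tofrac1 mulr1.
Qed.

Lemma assoc_div_sym : symmetric assoc_div.
Proof. by move=> x y; apply/idP/idP; apply: assoc_div_symW. Qed.

Lemma assoc_div_trans : transitive assoc_div.
Proof.
move=> y x z /asboolP[u Uu eu] /asboolP[w Uw ew]; apply/asboolP.
by exists (w * u); rewrite ?unitrM ?Uu ?Uw // eu ew tofracM mulrA.
Qed.

Canonical assoc_div_equiv :=
  EquivRel assoc_div assoc_div_refl assoc_div_sym assoc_div_trans.

(* The group of divisibility Q(R)^* / R^*. *)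
Definition Gamma := {eq_quot assoc_div}.
HB.instance Definition _ : EqQuotient _ assoc_div Gamma :=
  EqQuotient.on Gamma.
HB.instance Definition _ := Choice.on Gamma.

Definition gpi (x : nz Q) : Gamma := \pi_Gamma x.

Lemma gpiP x y : reflect (exists2 u : R, u \is a GRing.unit & val x = val y * u%:F)
                         (gpi x == gpi y).
Proof. by rewrite /gpi eqmodE; apply: asboolP. Qed.

Lemma gpi_repr (d : Gamma) : gpi (repr d) = d.
Proof. exact: reprK. Qed.

Definition Gmul (d e : Gamma) : Gamma := gpi (nzmul (repr d) (repr e)).
Definition Ginv (d : Gamma) : Gamma := gpi (nzinv (repr d)).
Definition Gone : Gamma := gpi (nz1 _).
Definition Gle (d e : Gamma) : bool :=
  `[< exists b : R, val (repr e) * (val (repr d))^-1 = b%:F >].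

Lemma repr_gpi x : exists2 u : R, u \is a GRing.unit &
  val (repr (gpi x)) = val x * u%:F.
Proof. by apply/gpiP; rewrite gpi_repr. Qed.

Lemma Gmul_gpi x y : Gmul (gpi x) (gpi y) = gpi (nzmul x y).
Proof.
apply/eqP/gpiP => /=.
have [u Uu ->] := repr_gpi x; have [w Uw ->] := repr_gpi y.
by exists (u * w); rewrite ?unitrM ?Uu // mulrACA tofracM.
Qed.

Lemma Ginv_gpi x : Ginv (gpi x) = gpi (nzinv x).
Proof.
apply/eqP/gpiP => /=; have [u Uu ->] := repr_gpi x.
by exists u^-1; rewrite ?unitrV // invfM tofrac_unitV.
Qed.

Lemma Gle_gpi x y :
  Gle (gpi x) (gpi y) = `[< exists b : R, val y * (val x)^-1 = b%:F >].
Proof.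
have [u Uu eu] := repr_gpi x; have [w Uw ew] := repr_gpi y.
apply: asbool_equiv_eq; rewrite eu ew; split=> -[b e].
  exists (b * u / w); rewrite !tofracM tofrac_unitV // -e.
  have u0 : u%:F != 0 :> Q by rewrite tofrac_eq0; apply: contraTneq Uu => ->; rewrite unitr0.
  have w0 : w%:F != 0 :> Q by rewrite tofrac_eq0; apply: contraTneq Uw => ->; rewrite unitr0.
  by rewrite invfM mulrACA -!mulrA [u%:F^-1 * _]mulrA mulVf // mul1r divff // mulr1.
exists (b * w / u); rewrite !tofracM tofrac_unitV // -e.
by rewrite invfM mulrACA !mulrA.
Qed.

Lemma Gamma_ind (P : Gamma -> Prop) : (forall x, P (gpi x)) -> forall d, P d.
Proof. by move=> h d; rewrite -(gpi_repr d). Qed.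

Lemma GmulC : commutative Gmul.
Proof.
elim/Gamma_ind=> x; elim/Gamma_ind=> y; rewrite !Gmul_gpi.
by congr gpi; apply: val_inj; rewrite /= mulrC.
Qed.
Lemma GmulA : associative Gmul.
Proof.
elim/Gamma_ind=> x; elim/Gamma_ind=> y; elim/Gamma_ind=> z; rewrite !Gmul_gpi.
by congr gpi; apply: val_inj; rewrite /= mulrA.
Qed.
Lemma Gmul1 : left_id Gone Gmul.
Proof.
elim/Gamma_ind=> x; rewrite Gmul_gpi.
by congr gpi; apply: val_inj; rewrite /= mul1r.
Qed.
Lemma GmulV : left_inverse Gone Ginv Gmul.
Proof.
elim/Gamma_ind=> x; rewrite Ginv_gpi Gmul_gpi.
by congr gpi; apply: val_inj; rewrite /= mulVf // (valP x).
Qed.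
Lemma Gmulr1 : right_id Gone Gmul.
Proof. by move=> d; rewrite GmulC Gmul1. Qed.
Lemma GmulrV : right_inverse Gone Ginv Gmul.
Proof. by move=> d; rewrite GmulC GmulV. Qed.
HB.instance Definition _ :=
  isGroup.Build Gamma GmulA Gmul1 Gmulr1 GmulV GmulrV.

Lemma Gle_refl : reflexive Gle.
Proof.
elim/Gamma_ind=> x; rewrite Gle_gpi; apply/asboolP; exists 1.
by rewrite divff ?(valP x) // tofrac1.
Qed.
Lemma Gle_anti : antisymmetric Gle.
Proof.
elim/Gamma_ind=> x; elim/Gamma_ind=> y; rewrite !Gle_gpi.
case/andP=> /asboolP[b eb] /asboolP[c ec]; apply/eqP/gpiP.
have x0 := valP x; have y0 := valP y; rewrite /= in x0 y0.
have cb : c * b = 1.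
  apply/eqP; rewrite -tofrac_eq tofracM -eb -ec tofrac1.
  by rewrite mulrA divfK // divff.
exists c; first by apply/unitrPr; exists b.
by rewrite -ec mulrC divfK.
Qed.
Lemma Gle_trans : transitive Gle.
Proof.
elim/Gamma_ind=> y; elim/Gamma_ind=> x; elim/Gamma_ind=> z; rewrite !Gle_gpi.
case/asboolP=> b eb /asboolP[c ec]; apply/asboolP; exists (c * b).
by rewrite tofracM -eb -ec mulrA divfK // (valP y).
Qed.

Fact Gamma_display : Order.disp_t. Proof. exact: Order.Disp tt tt. Qed.
HB.instance Definition _ :=
  Order.Le_isPOrder.Build Gamma_display Gamma Gle_refl Gle_anti Gle_trans.

Lemma tofrac_nz_subproof (a : nz R) : (val a)%:F != 0.
Proof. by rewrite tofrac_eq0 (valP a). Qed.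

Definition divval (a : nz R) : Gamma :=
  gpi (NZ (tofrac_nz_subproof a)).

Lemma tofracE (a : R) : a%:F = \pi_Q (Ratio a 1).
Proof. by rewrite piE. Qed.

Lemma frac_repr (q : Q) : q = (\n_(repr q))%:F / (\d_(repr q))%:F.
Proof.
have d0 : (\d_(repr q))%:F != 0 :> Q by rewrite tofrac_eq0 denom_ratioP.
apply: (canRL (mulfK d0)); rewrite -{1}[q]reprK !tofracE.
rewrite -[LHS]/(FracField.mul _ _) -FracField.pi_mul.
apply/eqP; rewrite FracField.equivf_def /FracField.mulf.
rewrite !numden_Ratio ?mulf_neq0 ?oner_neq0 ?denom_ratioP //.
by rewrite !mulr1 mulrC.
Qed.

Lemma gnum_subproof (x : nz Q) : \n_(repr (val x)) != 0.
Proof.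
apply/eqP => n0; have := valP x.
by rewrite /= [val x]frac_repr n0 tofrac0 mul0r eqxx.
Qed.

(* d = divval (gnum d) / divval (gden d), see gnumdenE. *)
Definition gnum (d : Gamma) : nz R := NZ (gnum_subproof (repr d)).
Definition gden (d : Gamma) : nz R :=
  NZ (denom_ratioP (repr (val (repr d)))).

Lemma gnumdenE d : d = (divval (gnum d) / divval (gden d))%g.
Proof.
rewrite -[RHS]/(Gmul _ (Ginv _)) Ginv_gpi Gmul_gpi -[LHS]gpi_repr.
by congr gpi; apply: val_inj; rewrite /= -frac_repr.
Qed.

Lemma divval_div_eq (a b c d : nz R) :
  (divval a / divval b = divval c / divval d)%g <->
  exists2 u : R, u \is a GRing.unit & val a * val d = val c * val b * u.
Proof.
rewrite -[X in X = _]/(Gmul _ (Ginv _)) -[X in _ = X]/(Gmul _ (Ginv _)).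
rewrite !Ginv_gpi !Gmul_gpi; have b0 := tofrac_nz_subproof b.
have d0 := tofrac_nz_subproof d.
have E u : ((val a)%:F / (val b)%:F == (val c)%:F / (val d)%:F * u%:F) =
           (val a * val d == val c * val b * u).
  by rewrite [in LHS]mulrAC eqr_div // -!tofracM tofrac_eq mulrAC.
split=> [/eqP/gpiP[u Uu /eqP e]|[u Uu e]].
  by exists u => //; apply/eqP; rewrite -E.
by apply/eqP/gpiP; exists u => //; apply/eqP; rewrite E; apply/eqP.
Qed.

End Divisibility.

Notation GammaPos R := {d : Gamma R | `[< exists a : nz R, d = divval a >]}.

(* Membership is boolean by the axioms of boolp, so {pred B} is all subsets;
   idealr_closed includes properness. *)
Record MSpec (B : idomainType) := MkMSpec {
  mideal : {pred B};
  mideal_closed : idealr_closed mideal;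
  mideal_max : forall I : {pred B},
    idealr_closed I -> {subset mideal <= I} -> {subset I <= mideal}
}.

Definition Vclosed (B : idomainType) (a : B) : set (MSpec B) :=
  [set M | a \in mideal M].

Inductive constructible (B : idomainType) : set (MSpec B) -> Prop :=
| constructible_V a : constructible (Vclosed a)
| constructible_C S : constructible S -> constructible (~` S)%classic
| constructible_U S T :
    constructible S -> constructible T -> constructible (S `|` T)%classic.

Section Localization.
Variables (B : idomainType) (M : MSpec B).
Local Notation Q := {fraction B}.
Local Notation m := (mideal M).

Lemma mideal0 : 0 \in m. Proof. by case: (mideal_closed M). Qed.
Lemma mideal1 : 1 \notin m. Proof. by case: (mideal_closed M). Qed.
Lemma midealD u v : u \in m -> v \in m -> u + v \in m.
Proof.
by case: (mideal_closed M) => _ _ h hu hv; rewrite -[u]mul1r h.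
Qed.
Lemma midealM a u : u \in m -> a * u \in m.
Proof.
by case: (mideal_closed M) => h0 _ h hu; rewrite -[_ * _]addr0 h.
Qed.

Lemma mideal_prime u v : u \notin m -> v \notin m -> u * v \notin m.
Proof.
move=> Nu Nv; apply/negP => uv.
pose I : {pred B} := fun x => `[< exists w b, w \in m /\ x = w + b * u >].
have IP x : reflect (exists w b, w \in m /\ x = w + b * u) (x \in I).
  exact: asboolP.
case: (boolP (1 \in I)) => [/IP[w [b [wm e]]]|I1].
  case/negP: Nv; rewrite -[v]mul1r e mulrDl midealD //.
    by rewrite mulrC midealM.
  by rewrite -mulrA midealM.
have Icl : idealr_closed I.
  split=> // [|a x y /IP[w [b [wm ->]]] /IP[w' [b' [wm' ->]]]].
    by apply/IP; exists 0, 0; rewrite mideal0 mul0r addr0.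
  apply/IP; exists (a * w + w'), (a * b + b'); split.
    by rewrite midealD ?midealM.
  by rewrite mulrDr mulrDl mulrA addrACA.
have mI : {subset m <= I}.
  by move=> x xm; apply/IP; exists x, 0; rewrite mul0r addr0.
case/negP: Nu; apply: (mideal_max Icl mI).
by apply/IP; exists 0, 1; rewrite mideal0 mul1r add0r.
Qed.

Lemma notin_mideal_neq0 s : s \notin m -> s%:F != 0.
Proof. by rewrite tofrac_eq0; apply: contraNneq => ->; exact: mideal0. Qed.

Definition in_loc : {pred Q} :=
  fun x => `[< exists a s : B, s \notin m /\ x = a%:F / s%:F >].

Lemma in_locP x :
  reflect (exists a s : B, s \notin m /\ x = a%:F / s%:F) (x \in in_loc).
Proof. exact: asboolP. Qed.

Lemma tofrac_in_loc b : b%:F \in in_loc.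
Proof.
by apply/in_locP; exists b, 1; rewrite mideal1 tofrac1 divr1.
Qed.

Lemma in_loc_subring : subring_closed in_loc.
Proof.
split=> [|x y|x y].
- by rewrite -tofrac1 tofrac_in_loc.
- move=> /in_locP[a [s [sm ->]]] /in_locP[b [t [tm ->]]]; apply/in_locP.
  exists (a * t - b * s), (s * t); split; first exact: mideal_prime.
  rewrite tofracB !tofracM invfM mulrBl mulrACA divff ?notin_mideal_neq0 //.
  rewrite mulr1 [s%:F^-1 * _]mulrC mulrACA divff ?notin_mideal_neq0 //.
  by rewrite mulr1.
- move=> /in_locP[a [s [sm ->]]] /in_locP[b [t [tm ->]]]; apply/in_locP.
  exists (a * b), (s * t); split; first exact: mideal_prime.
  by rewrite !tofracM invfM mulrACA.
Qed.
HB.instance Definition _ := GRing.isSubringClosed.Build Q in_loc in_loc_subring.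

Record loc := MkLoc { locval :> Q; locP : locval \in in_loc }.
HB.instance Definition _ := [isSub for locval].
HB.instance Definition _ := [Choice of loc by <:].
HB.instance Definition _ := [SubChoice_isSubComNzRing of loc by <:].

Definition loc_unit : {pred loc} :=
  fun x => (val x != 0) && ((val x)^-1 \in in_loc).
Definition loc_inv (x : loc) : loc :=
  if x \in loc_unit then insubd x (val x)^-1 else x.

Lemma loc_mulVx : {in loc_unit, left_inverse 1 loc_inv *%R}.
Proof.
move=> x xU; rewrite /loc_inv xU; case/andP: xU => x0 xV.
by apply: val_inj; rewrite /= val_insubd xV mulVf.
Qed.
Lemma loc_unitPl (x y : loc) : y * x = 1 -> x \in loc_unit.
Proof.
move=> /(congr1 val) /= yx1.
have x0 : val x != 0.
  by apply/eqP => x0; have := oner_neq0 Q; rewrite -yx1 x0 mulr0 eqxx.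
rewrite unfold_in /loc_unit x0 /=.
suff -> : (val x)^-1 = val y by exact: valP.
by rewrite -[RHS](mulfK x0) yx1 mul1r.
Qed.
Lemma loc_invr_out : {in [predC loc_unit], loc_inv =1 id}.
Proof. by move=> x; rewrite inE /= /loc_inv => /negPf ->. Qed.
HB.instance Definition _ := GRing.ComNzRing_hasMulInverse.Build loc
  loc_mulVx loc_unitPl loc_invr_out.

Lemma loc_integral (x y : loc) : x * y = 0 -> (x == 0) || (y == 0).
Proof.
by move=> /(congr1 val) /eqP; rewrite /= mulf_eq0 -!(inj_eq val_inj).
Qed.
HB.instance Definition _ :=
  GRing.ComUnitRing_isIntegral.Build loc loc_integral.

Definition toloc (b : B) : loc := MkLoc (tofrac_in_loc b).
Lemma toloc_zmod : zmod_morphism toloc.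
Proof. by move=> x y; apply: val_inj; rewrite /= tofracB. Qed.
Lemma toloc_monoid : monoid_morphism toloc.
Proof.
by split=> [|x y]; apply: val_inj; rewrite /= ?tofrac1 ?tofracM.
Qed.
HB.instance Definition _ := GRing.isZmodMorphism.Build B loc toloc toloc_zmod.
HB.instance Definition _ :=
  GRing.isMonoidMorphism.Build B loc toloc toloc_monoid.

Lemma toloc_nz_subproof (a : nz B) : toloc (val a) != 0.
Proof. by rewrite -(inj_eq val_inj) /= tofrac_eq0 (valP a). Qed.
Definition tolocnz (a : nz B) : nz loc := NZ (toloc_nz_subproof a).

(* The map d |-> d_M induced on groups of divisibility by B -> B_M;
   divval (tolocnz a) is the class of a in Gamma(B_M). *)
Definition Gamma_loc (d : Gamma B) : Gamma loc :=
  (divval (tolocnz (gnum d)) / divval (tolocnz (gden d)))%g.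

Lemma Gamma_loc_div (a b : nz B) : Gamma_loc (divval a / divval b)%g =
  (divval (tolocnz a) / divval (tolocnz b))%g.
Proof.
have [u Uu e] := (divval_div_eq _ _ _ _).1 (gnumdenE (divval a / divval b)%g).
apply/divval_div_eq; exists (toloc u^-1); first by rewrite rmorph_unit ?unitrV.
by rewrite /= -!rmorphM e -!mulrA mulrV // mulr1 mulrC.
Qed.

End Localization.

(* Terms and atomic formulas with variables in X, scalars in S and predicate
   symbols V_d, d in D: L_{R,V} is the case S = R, D = GammaPos R. *)
Inductive lterm (S X : Type) : Type :=
| Var of X
| Zero
| Opp of lterm S X
| Add of lterm S X & lterm S X
| Act of lterm S X & S.
Arguments Zero {S X}.
Arguments Var {S X} x.

Inductive latom (S D X : Type) : Type :=
| Eqn of lterm S X & lterm S X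
| Vpred of D & lterm S X.
Arguments Eqn {S D X} t u.
Arguments Vpred {S D X} d t.

Notation lconj S D X := (seq (latom S D X)).

(* exists x_0 .. x_(r-1), theta(z, x), with r = pp_bound; the variables of
   theta are z_i = inl i and x_j = inr j. *)
Record ppform (S D : Type) (n : nat) := PPForm {
  pp_bound : nat;
  pp_matrix : lconj S D ('I_n + 'I_pp_bound)
}.

Record Lstruct (S D : Type) := MkLstruct {
  carrier : zmodType;
  sact : carrier -> S -> carrier;
  svpred : D -> carrier -> Prop
}.

Section Semantics.
Variables (S D : Type) (A : Lstruct S D).

Fixpoint teval X (e : X -> carrier A) (t : lterm S X) : carrier A :=
  match t with
  | Var x => e x
  | Zero => 0
  | Opp t => - teval e t
  | Add t u => teval e t + teval e u
  | Act t a => sact (teval e t) a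
  end.

Definition sat_atom X (e : X -> carrier A) (f : latom S D X) : Prop :=
  match f with
  | Eqn t u => teval e t = teval e u
  | Vpred d t => svpred d (teval e t)
  end.

Definition sat_conj X (e : X -> carrier A) (c : lconj S D X) : Prop :=
  foldr (fun f P => sat_atom e f /\ P) True c.

Definition sat_pp n (z : 'I_n -> carrier A) (phi : ppform S D n) : Prop :=
  exists x : 'I_(pp_bound phi) -> carrier A,
    sat_conj (fun v => match v with inl i => z i | inr j => x j end)
             (pp_matrix phi).

End Semantics.

Fixpoint map_term S S' X (f : S -> S') (t : lterm S X) : lterm S' X :=
  match t with
  | Var x => Var x
  | Zero => Zero
  | Opp t => Opp (map_term f t)
  | Add t u => Add (map_term f t) (map_term f u)
  | Act t a => Act (map_term f t) (f a)
  end.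

Definition map_atom S S' D D' X (f : S -> S') (g : D -> D')
    (p : latom S D X) : latom S' D' X :=
  match p with
  | Eqn t u => Eqn (map_term f t) (map_term f u)
  | Vpred d t => Vpred (g d) (map_term f t)
  end.

Definition map_conj S S' D D' X (f : S -> S') (g : D -> D')
    (c : lconj S D X) : lconj S' D' X := map (map_atom f g) c.

Definition mod_struct (R : idomainType) (N : lmodType R) :
    Lstruct R (GammaPos R) :=
  MkLstruct (fun (m : N) (a : R) => a *: m)
    (fun d m => exists2 a : nz R, val d = divval a &
                exists n : N, m = val a *: n).

Section Restriction.
Variables (R S : idomainType) (f : {rmorphism R -> S}) (N : lmodType S).

(* g is a phantom argument: it determines the R-module structure below. *)
Definition restr (g : {rmorphism R -> S}) : Type := N.

HB.instance Definition _ := GRing.Zmodule.on (restr f).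

Definition restr_scale (a : R) (m : restr f) : restr f := f a *: (m : N).
Lemma restr_scaleA a b m :
  restr_scale a (restr_scale b m) = restr_scale (a * b) m.
Proof. by rewrite /restr_scale scalerA rmorphM. Qed.
Lemma restr_scale1 : left_id 1 restr_scale.
Proof. by move=> m; rewrite /restr_scale rmorph1 scale1r. Qed.
Lemma restr_scaleDr : right_distributive restr_scale +%R.
Proof. by move=> a u v; rewrite /restr_scale scalerDr. Qed.
Lemma restr_scaleDl m : {morph restr_scale^~ m : a b / a + b}.
Proof. by move=> a b; rewrite /restr_scale rmorphD scalerDl. Qed.
HB.instance Definition _ := GRing.Zmodule_isLmodule.Build R (restr f)
  restr_scaleA restr_scale1 restr_scaleDr restr_scaleDl.

Lemma restr_scaleE (a : R) (m : restr f) : a *: m = f a *: (m : N) :> N.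
Proof. by []. Qed.
End Restriction.

(* The formula c over Q(B) and Gamma(B), read at M, is the L_{B_M,V}-formula
   psi. Such a psi exists iff all scalars of c lie in B_M and d_M is in
   Gamma(B_M)^+ for all predicates V_d of c. *)
Definition reads_as (B : idomainType) (M : MSpec B) X
    (c : lconj {fraction B} (Gamma B) X)
    (psi : lconj (loc M) (GammaPos (loc M)) X) : Prop :=
  map_conj id (Gamma_loc M) c = map_conj (@locval B M) val psi.

Definition equiv_in_Mod (B : idomainType) (M : MSpec B) n
    (phi : ppform B (GammaPos B) n)
    (psi : lconj (loc M) (GammaPos (loc M)) 'I_n) : Prop :=
  forall (N : lmodType (loc M)) (z : 'I_n -> N),
    sat_pp (A := mod_struct (restr N (@toloc B M))) z phi <->
    sat_conj (A := mod_struct N) z psi.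

(* z.a = 0 /\ V_(d_0)(z.b_0) /\ ... /\ V_(d_(n-1))(z.b_(n-1)) *)
Definition one_var_conj (R : idomainType) (a : R) n (b : 'I_n -> nz R)
    (d : 'I_n -> GammaPos R) : lconj R (GammaPos R) 'I_1 :=
  Eqn (Act (Var ord0) a) Zero ::
  [seq Vpred (d i) (Act (Var ord0) (val (b i))) | i <- enum 'I_n].

(* Main.v *)
Require Import Defs.
From HB Require Import structures.
From mathcomp Require Import all_boot all_order all_algebra.
From mathcomp Require Import perm generic_quotient fraction.
From mathcomp Require Import boolp classical_sets.

Set Implicit Arguments.
Unset Strict Implicit.
Unset Printing Implicit Defensive.

Import Order.TTheory GRing.Theory.
Local Open Scope ring_scope.

(* With one extra bound variable per predicate V_d, phi(z) is a linear system
   z A = w C to be solved for w. Over a valuation domain L C T = diag(d) for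
   some invertible L and T, and the system is solvable iff each d_j divides the
   j-th entry of z A T: a conjunction of atoms. This is uniform in M because
   the diagonalization only uses tests q in B_M for q in Q(B): writing q = a/b
   with (a, b) = B, which is possible as B is Bezout, the test reads b not in M,
   which is constructible, and q or 1/q passes it. In one variable, V_d(z.b)
   implies V_d'(z.b') when v(b) <= v(b') and v(d')/v(b') <= v(d)/v(b), so the
   conditions that remain once the redundant ones are removed form a chain. *)

(** * Membership in localizations, constructible sets and piecewise choices *)

Section Bezout.
Variables (B : idomainType) (bezoutB : bezout B).
Local Notation Q := {fraction B}.

(** Numerator and denominator are divided by a generator [d] of the ideal they span; cancelling [d]
    in its expression through them leaves the Bezout relation. *)
Lemma bezout_frac (q : Q) :
  exists a b u v : B, [/\ b != 0, u * a + v * b = 1 & q = a%:F / b%:F].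
Proof.
set a := \n_(repr q); set b := \d_(repr q).
have b0 : b != 0 by rewrite denom_ratioP.
pose e (i : 'I_2) := if val i == 0%N then a else b.
have [d ed] := bezoutB e.
have [c /esym dE] : ideal_gen e d by rewrite ed; exists 1; rewrite mul1r.
have [a' aE] : principal_ideal d a.
  rewrite -ed; exists (fun i => (i == ord0)%:R).
  by rewrite !big_ord_recl big_ord0 /e /= mul1r mul0r !addr0.
have [b' bE] : principal_ideal d b.
  rewrite -ed; exists (fun i => (i != ord0)%:R).
  by rewrite !big_ord_recl big_ord0 /e /= mul1r mul0r !addr0 add0r.
have /andP[b'0 d0] : (b' != 0) && (d != 0) by rewrite -negb_or -mulf_eq0 -bE.
exists a', b', (c ord0), (c (lift ord0 ord0)); split => //.
  apply: (mulIf d0); rewrite mul1r -[RHS]dE !big_ord_recl big_ord0 /e /=.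
  by rewrite addr0 mulrDl -!mulrA -aE -bE.
rewrite [LHS]frac_repr -/a -/b aE bE !tofracM invfM mulrACA divff ?mulr1 //.
by rewrite tofrac_eq0.
Qed.

(** If [a/b = c/s] with [s] outside M, then [a s = c b]. Were [b] in M, primality would put [a] in
    M, and with it [1 = u a + v b]. *)
Lemma mem_in_locE M (a b u v : B) : u * a + v * b = 1 -> b != 0 ->
  (a%:F / b%:F \in in_loc M) = (b \notin mideal M).
Proof.
move=> uv b0; apply/in_locP/idP => [[c [s [sM e]]]|bM]; last by exists a, b.
apply: contra (mideal1 M) => bM; rewrite -uv midealD ?midealM //.
have s0 := notin_mideal_neq0 sM.
have /eqP : a * s = c * b.
  apply/eqP; rewrite -tofrac_eq !tofracM -eqr_div ?tofrac_eq0 ?e //.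
  by move: s0; rewrite tofrac_eq0.
apply: contraTT => aM; apply/eqP => e'.
by have := mideal_prime aM sM; rewrite e' midealM.
Qed.

Lemma constructible_in_loc (q : Q) :
  constructible [set M : MSpec B | q \in in_loc M]%classic.
Proof.
have [a [b [u [v [b0 uv ->]]]]] := bezout_frac q.
suff -> : [set M : MSpec B | a%:F / b%:F \in in_loc M]%classic =
  (~` Vclosed b)%classic by exact/constructible_C/constructible_V.
by apply/seteqP; split=> M /=; rewrite (mem_in_locE M uv b0) => /negP.
Qed.

(** In coprime form the denominators of [q] and [1/q] are [b] and [a], and M cannot contain both. *)
Lemma in_loc_valuation M (q : Q) : (q \in in_loc M) || (q^-1 \in in_loc M).
Proof.
have [a [b [u [v [b0 uv ->]]]]] := bezout_frac q.
have [->|a0] := eqVneq a 0; first by rewrite tofrac0 mul0r rpred0.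
have vu : v * b + u * a = 1 by rewrite addrC.
rewrite invf_div (mem_in_locE M uv b0) (mem_in_locE M vu a0) -negb_and.
apply: contra (mideal1 M) => /andP[bM aM].
by rewrite -uv midealD ?midealM.
Qed.

Lemma constructible0 : constructible (set0 : set (MSpec B)).
Proof.
suff -> : set0 = Vclosed (1 : B) by exact: constructible_V.
by apply/seteqP; split=> M //; rewrite /Vclosed /= (negPf (mideal1 M)).
Qed.

Lemma constructibleT : constructible (setT : set (MSpec B)).
Proof. by rewrite -setC0; exact/constructible_C/constructible0. Qed.

Lemma constructibleI (S T : set (MSpec B)) :
  constructible S -> constructible T -> constructible (S `&` T)%classic.
Proof.
move=> cS cT; rewrite -[(S `&` T)%classic]setCK setCI.
exact/constructible_C/constructible_U/constructible_C/cT/constructible_C.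
Qed.

Lemma constructible_forall (I : finType) (S : I -> set (MSpec B)) :
  (forall i, constructible (S i)) ->
  constructible [set M | forall i, S i M]%classic.
Proof.
move=> cS; suff h (s : seq I) :
    constructible [set M | forall i, i \in s -> S i M]%classic.
  suff -> : [set M | forall i, S i M]%classic =
    [set M | forall i, i \in enum I -> S i M]%classic by exact: h.
  by apply/seteqP; split=> M /= + i => /(_ i) //; apply; rewrite mem_enum.
elim: s => [|i s IH].
  suff -> : [set M : MSpec B | forall i, i \in [::] -> S i M]%classic = setT.
    exact: constructibleT.
  by apply/seteqP; split.
suff -> : [set M | forall j, j \in i :: s -> S j M]%classic =
    (S i `&` [set M | forall j, j \in s -> S j M])%classic.
  exact: constructibleI.
apply/seteqP; split=> M /=.
  by move=> h; split=> [|j js]; apply: h; rewrite inE ?eqxx ?js ?orbT.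
by case=> h1 h2 j; rewrite inE => /predU1P[->|/h2].
Qed.

(** The type [T] does not depend on [M], so the value on a piece is uniform in [M]; this is why
    matrices and formulas are taken over [Q(B)]. Pieces may overlap. *)
Definition piecewise T (P : MSpec B -> T -> Prop) : Prop :=
  exists (K : finType) (C : K -> set (MSpec B)) (t : K -> T),
    [/\ forall k, constructible (C k), forall M, exists k, C k M
      & forall k M, C k M -> P M (t k)].

Lemma piecewise_map T U (f : T -> U) (P : MSpec B -> T -> Prop)
    (P' : MSpec B -> U -> Prop) :
  piecewise P -> (forall M t, P M t -> P' M (f t)) -> piecewise P'.
Proof.
move=> [K [C [t [cC covC tP]]]] PP'; exists K, C, (f \o t); split=> // k M CM.
exact/PP'/tP.
Qed.

Lemma piecewise_cst T (t : T) (P : MSpec B -> T -> Prop) :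
  (forall M, P M t) -> piecewise P.
Proof.
move=> Pt; exists unit, (fun=> setT), (fun=> t); split.
- by move=> _; exact: constructibleT.
- by exists tt.
- by [].
Qed.

(** Each [i] comes with a cover of the whole of [MSpec B]; cutting it with [S i] gives pieces
    indexed by the pairs (i, k). *)
Lemma piecewise_cover T (I : finType) (S : I -> set (MSpec B))
    (P : MSpec B -> T -> Prop) :
  (forall i, constructible (S i)) -> (forall M, exists i, S i M) ->
  (forall i, piecewise (fun M t => S i M -> P M t)) -> piecewise P.
Proof.
move=> cS covS pwP.
(* A cover and its values are packed into one type, so that [choice] can select them for all [i] at
   once. *)
pose data := {K : finType & ((K -> set (MSpec B)) * (K -> T))%type}.
have /choice[D DP] i : exists D : data,
    [/\ forall k, constructible ((tagged D).1 k),
        forall M, exists k, (tagged D).1 k M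
      & forall k M, (tagged D).1 k M -> S i M -> P M ((tagged D).2 k)].
  by have [K [C [t ?]]] := pwP i; exists (existT _ K (C, t)).
exists {i : I & tag (D i)},
  (fun k => (S (tag k) `&` (tagged (D (tag k))).1 (tagged k))%classic),
  (fun k => (tagged (D (tag k))).2 (tagged k)); split=> [[i k]|M|[i k] M] /=.
- by apply: constructibleI => //; case: (DP i).
- have [i SiM] := covS M; have [_ /(_ M)[k kM] _] := DP i.
  by exists (existT _ i k).
- by case=> SiM CM; have [_ _ h] := DP i; apply: h.
Qed.

End Bezout.

(** * Invertible matrices over a subring of a field, and diagonalization *)

Section GeneralLinear.
Variables (F : fieldType) (O : subringClosed F).

(** This is GL_n(O) inside M_n(F): a right inverse of a square matrix is two-sided. *)
Definition GLover n (L : 'M[F]_n) : Prop :=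
  L \is a mxOver O /\ exists2 L', L' \is a mxOver O & L *m L' = 1%:M.

Lemma GLover1 n : GLover (1%:M : 'M_n).
Proof.
have h : (1%:M : 'M[F]_n) \is a mxOver O.
  by rewrite mxOver_scalar ?rpred0 ?rpred1.
by split=> //; exists 1%:M; rewrite ?mulmx1.
Qed.

Lemma GLoverM n (L R : 'M_n) : GLover L -> GLover R -> GLover (L *m R).
Proof.
move=> [OL [L' OL' LL']] [OR [R' OR' RR']]; split; first exact: mxOverM.
exists (R' *m L'); first exact: mxOverM.
by rewrite -mulmxA (mulmxA R) RR' mul1mx.
Qed.

Lemma GLover_tperm n (i j : 'I_n) : GLover (tperm_mx i j).
Proof.
have h : (tperm_mx i j : 'M[F]_n) \is a mxOver O.
  by apply/mxOverP=> k l; rewrite !mxE; case: eqP; rewrite ?rpred0 ?rpred1.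
by split=> //; exists (tperm_mx i j); rewrite // -perm_mxM tperm2 perm_mx1.
Qed.

Lemma mxOver_block m1 m2 n1 n2 (A : 'M[F]_(m1, n1)) (B : 'M_(m1, n2))
    (C : 'M_(m2, n1)) (D : 'M_(m2, n2)) :
  A \is a mxOver O -> B \is a mxOver O -> C \is a mxOver O ->
  D \is a mxOver O -> block_mx A B C D \is a mxOver O.
Proof.
move=> /mxOverP OA /mxOverP OB /mxOverP OC /mxOverP OD; apply/mxOverP=> i j.
by rewrite !mxE; case: split => i'; rewrite mxE; case: split => j'.
Qed.

(** The matrix is a unipotent block matrix times diag(1, R): one elimination step followed by the
    transformation of the remaining block. The lower triangular case is symmetric. *)
Lemma GLover_ublock m n (R : 'M_n) (u : 'M_(m, n)) :
  GLover R -> u \is a mxOver O -> GLover (block_mx 1%:M (u *m R) 0 R).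
Proof.
move=> [OR [R' OR' RR']] Ou.
have O1 k : (1%:M : 'M[F]_k) \is a mxOver O := (GLover1 k).1.
have O0 k l : (0 : 'M[F]_(k, l)) \is a mxOver O by rewrite rpred0.
split; first by rewrite mxOver_block ?mxOverM.
exists (block_mx 1%:M (- u) 0 R'); first by rewrite mxOver_block ?rpredN.
rewrite mulmx_block !mulmx0 !mul0mx !mulmx1 !mul1mx !addr0 RR' add0r.
by rewrite -mulmxA RR' mulmx1 addNr -scalar_mx_block.
Qed.

Lemma GLover_lblock m n (L : 'M_n) (u : 'M_(n, m)) :
  GLover L -> u \is a mxOver O -> GLover (block_mx 1%:M 0 (L *m u) L).
Proof.
move=> [OL [L' OL' LL']] Ou.
have O1 k : (1%:M : 'M[F]_k) \is a mxOver O := (GLover1 k).1.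
have O0 k l : (0 : 'M[F]_(k, l)) \is a mxOver O by rewrite rpred0.
split; first by rewrite mxOver_block ?mxOverM.
exists (block_mx 1%:M 0 (- u) L'); first by rewrite mxOver_block ?rpredN.
rewrite mulmx_block !mulmx0 !mul0mx !mulmx1 ?mul1mx !addr0 LL' add0r.
by rewrite mulmxN addrN -scalar_mx_block.
Qed.

(** Only [R] and [d] are exposed because the resulting divisibility conditions do not involve [L],
    which may thus vary with [M]. *)
Definition diagonalizes n (A R : 'M[F]_n) (d : 'rV_n) : Prop :=
  exists L, [/\ GLover L, GLover R & L *m A *m R = diag_mx d].

Lemma diagonalizes_perm n (A R : 'M_n) d i1 j1 i2 j2 :
  diagonalizes (tperm_mx i1 i2 *m A *m tperm_mx j1 j2) R d ->
  diagonalizes A (tperm_mx j1 j2 *m R) d.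
Proof.
move=> [L [GL GR E]]; exists (L *m tperm_mx i1 i2).
split; rewrite -?E ?mulmxA //; apply: GLoverM => //; apply: GLover_tperm.
Qed.

(* The block left after clearing the pivot's row and column is its Schur
   complement. *)
Lemma diagonalizes_pivot n (p : F) (r : 'rV_n) (c : 'cV_n) (A R : 'M_n) d :
  p != 0 -> p^-1 *: r \is a mxOver O -> p^-1 *: c \is a mxOver O ->
  diagonalizes (A - p^-1 *: (c *m r)) R d ->
  diagonalizes (block_mx p%:M r c A)
    (block_mx (1%:M : 'M_1) ((- (p^-1 *: r)) *m R) 0 R) (row_mx (const_mx p) d).
Proof.
move=> p0 Or Oc [L [GL GR E]].
exists (block_mx 1%:M 0 (L *m (- (p^-1 *: c))) L); split.
- by apply: GLover_lblock => //; rewrite rpredN.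
- by apply: GLover_ublock => //; rewrite rpredN.
rewrite mulmx_block !mul1mx !mul0mx !addr0.
have -> : L *m (- (p^-1 *: c)) *m p%:M + L *m c = 0.
  rewrite mul_mx_scalar mulmxN scalerN -scalemxAr scalerA divff //.
  by rewrite scale1r addNr.
have -> : L *m (- (p^-1 *: c)) *m r + L *m A = L *m (A - p^-1 *: (c *m r)).
  by rewrite -mulmxA mulNmx -scalemxAl mulmxDr addrC.
rewrite mulmx_block !mulmx1 !mulmx0 !mul0mx !addr0 add0r E.
rewrite mulmxA mulmxN -scalemxAr mul_scalar_mx scalerA mulVf // scale1r.
by rewrite mulNmx addNr diag_mx_row diag_const_mx.
Qed.

End GeneralLinear.

(** * Diagonalization uniform on constructible pieces *)

Section PiecewiseDiagonalization.
Variables (B : idomainType) (bezoutB : bezout B).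
Local Notation Q := {fraction B}.

(** By [in_loc_valuation], divisibility in [B_M] is a total preorder on the nonzero entries; a least
    one is a pivot. *)
Lemma exists_pivot M m n (A : 'M[Q]_(m, n)) : A != 0 ->
  exists2 p : 'I_m * 'I_n, A p.1 p.2 != 0 &
    forall k l, A k l / A p.1 p.2 \in in_loc M.
Proof.
move=> A0.
have [p0 p0P] : exists p : 'I_m * 'I_n, A p.1 p.2 != 0.
  apply/existsP; apply: contraNT A0 => /existsPn A0.
  by apply/eqP/matrixP => i j; have /negPn/eqP := A0 (i, j); rewrite mxE.
pose ord (x y : Q) := y / x \in in_loc M.
(* The side conditions are reflexivity, transitivity and totality of [ord], and a starting nonzero
   entry. *)
have [||||p pP pmin] := @extremum_inP _ _ ord p0
    (fun p => A p.1 p.2 != 0) (fun p => A p.1 p.2).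
- by move=> p pP; rewrite /= /ord divff ?rpred1.
- move=> y x z yP xP zP /= xy yz; rewrite /ord.
  have y0 : A y.1 y.2 != 0 := yP.
  by rewrite -(divfK y0 (A z.1 z.2)) -[_ * _ / _]mulrA rpredM.
- move=> x y xP yP /=; rewrite /ord -[X in _ || (X \in _)]invf_div.
  exact: in_loc_valuation.
- exact: p0P.
exists p => // k l; have [->|kl0] := eqVneq (A k l) 0.
  by rewrite mul0r rpred0.
exact: (pmin (k, l)).
Qed.

(** There is one piece per nonzero entry: the set of [M] for which it divides all entries. On it the
    Schur complement is the same for all [M], and the induction applies to it since [A] may have any
    entries in [Q(B)]. *)
Lemma piecewise_diagonalizes n (A : 'M[Q]_n) :
  piecewise (fun M (t : 'M_n * 'rV_n) => diagonalizes (in_loc M) A t.1 t.2).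
Proof.
elim: n A => [|n IH] A.
  apply: (@piecewise_cst _ _ (1%:M, 0)) => M; exists 1%:M.
  by split; rewrite ?[LHS]flatmx0 ?[RHS]flatmx0 //; apply: GLover1.
have [->|A0] := eqVneq A 0.
  apply: (@piecewise_cst _ _ (1%:M, 0)) => M; exists 1%:M.
  by split; rewrite ?mulmx0 ?mul0mx ?linear0 //; apply: GLover1.
pose I := {p : 'I_n.+1 * 'I_n.+1 | A p.1 p.2 != 0}.
pose S (p : I) := [set M : MSpec B | forall q : 'I_n.+1 * 'I_n.+1,
  A q.1 q.2 / A (val p).1 (val p).2 \in in_loc M]%classic.
apply: (@piecewise_cover _ _ I S) => [p|M|[[i j] /= p0]].
- by apply: constructible_forall => q; apply: constructible_in_loc.
- have [p pP pmin] := exists_pivot M A0.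
  by exists (exist _ p pP) => q; apply: pmin.
pose A1 : 'M_(1 + n) := tperm_mx ord0 i *m A *m tperm_mx j ord0.
have A1E k l : A1 k l = A (tperm ord0 i k) (tperm j ord0 l).
  by rewrite /A1 -xcolE -xrowE !mxE.
pose p := A i j; pose r := ursubmx A1; pose c := dlsubmx A1.
have A1_block : A1 = block_mx p%:M r c (drsubmx A1).
  rewrite -[LHS]submxK; congr block_mx; rewrite [LHS]mx11_scalar.
  by rewrite 2!mxE A1E lshift0 tpermL tpermR.
(* [f] turns a diagonalization of the Schur complement into one of [A] by a formula free of [M]. *)
pose f (t : 'M[Q]_n * 'rV[Q]_n) :=
  (tperm_mx j ord0 *m
     block_mx (1%:M : 'M_1) ((- (p^-1 *: r)) *m t.1) 0 t.1 : 'M_n.+1,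
   row_mx (const_mx p : 'rV_1) t.2 : 'rV_n.+1).
have := IH (drsubmx A1 - p^-1 *: (c *m r)).
move=> /(piecewise_map (f := f)); apply => M [R d] /= diagS pmin.
apply: (@diagonalizes_perm _ _ _ _ _ _ ord0 j i ord0).
rewrite [X in diagonalizes _ X _ _](_ : _ = A1) // A1_block.
have pA k l : p^-1 * A1 k l \in in_loc M.
  by rewrite A1E mulrC; apply: (pmin (_, _)).
apply: diagonalizes_pivot diagS => //; apply/mxOverP => k l;
  by rewrite 3!mxE pA.
Qed.
End PiecewiseDiagonalization.

(** * Linear systems in a module *)

Section LinearAction.
Variables (R : comNzRingType) (N : lmodType R).

(** The product of the row vector [z] by [A]; [z] is a function because its entries lie in a
    module. *)
Definition vact m n (z : 'I_m -> N) (A : 'M[R]_(m, n)) (j : 'I_n) : N :=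
  \sum_i A i j *: z i.

Lemma vactM m n p (z : 'I_m -> N) (A : 'M_(m, n)) (C : 'M_(n, p)) :
  vact (vact z A) C =1 vact z (A *m C).
Proof.
move=> j; rewrite /vact; under eq_bigr do rewrite scaler_sumr.
rewrite exchange_big; apply: eq_bigr => i _; rewrite mxE scaler_suml.
by apply: eq_bigr => k _; rewrite scalerA mulrC.
Qed.

Lemma eq_vact m n (z z' : 'I_m -> N) (A : 'M_(m, n)) :
  z =1 z' -> vact z A =1 vact z' A.
Proof. by move=> zz' j; apply: eq_bigr => i _; rewrite zz'. Qed.

Lemma vact_diag n (z : 'I_n -> N) (d : 'rV_n) j :
  vact z (diag_mx d) j = d 0 j *: z j.
Proof.
rewrite /vact (bigD1 j) //= mxE eqxx mulr1n big1 ?addr0 // => i.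
by move=> /negPf ij; rewrite mxE ij mulr0n scale0r.
Qed.

(** The substitution [w = y L] and right multiplication by [T] turn [z A = w C] into
    [z A T = y diag(d)], whose columns are independent of each other. *)
Lemma solvable_diag n s (A : 'M_(n, s)) (C L L' T T' : 'M_s) (d : 'rV_s)
    (z : 'I_n -> N) :
  L *m L' = 1%:M -> T *m T' = 1%:M -> L *m C *m T = diag_mx d ->
  (exists w : 'I_s -> N, vact z A =1 vact w C) <->
  (forall j, exists y, vact z (A *m T) j = d 0 j *: y).
Proof.
move=> LL' TT' LCT; have L'L := mulmx1C LL'.
split=> [[w e] j|/choice[y e]].
  exists (vact w L' j); rewrite -vactM (eq_vact _ e) vactM -vact_diag -LCT.
  by rewrite vactM !mulmxA L'L mul1mx.
exists (vact y L) => j; rewrite vactM.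
have -> : L *m C = diag_mx d *m T' by rewrite -LCT -mulmxA TT' mulmx1.
rewrite -vactM -(eq_vact _ (fun k => etrans (e k) (esym (vact_diag _ _ _)))).
by rewrite vactM -mulmxA TT' mulmx1.
Qed.

End LinearAction.

(** * Atoms as divisibility conditions on linear forms *)

Lemma divval_eqP (R : idomainType) (a b : nz R) :
  divval a = divval b -> exists c, val a = val b * c.
Proof.
move=> /eqP/gpiP[u _ /= e]; exists u; apply/eqP.
by rewrite -tofrac_eq e tofracM.
Qed.

(** Any other representative of [d] is a multiple of [a], so the choice of representative does not
    matter. *)
Lemma svpred_divval (R : idomainType) (N : lmodType R) (d : GammaPos R)
    (a : nz R) (m : N) : val d = divval a ->
  svpred (l := mod_struct N) d m <-> exists n : N, m = val a *: n.
Proof.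
move=> da; split=> [[b db [n ->]]|[n ->]]; last by exists a => //; exists n.
have [c ->] : exists c, val b = val a * c by apply: divval_eqP; rewrite -da.
by exists (c *: n); rewrite scalerA.
Qed.

Definition GammaPos_divval (R : idomainType) (a : nz R) : GammaPos R :=
  exist _ (divval a) (asboolT (ex_intro _ a erefl)).

Lemma svpred_GammaPos_divval (R : idomainType) (N : lmodType R) (a : nz R)
    (m : N) :
  svpred (l := mod_struct N) (GammaPos_divval a) m <->
  exists n : N, m = val a *: n.
Proof. exact: svpred_divval. Qed.

Section Linearization.
Variables (R : idomainType) (X : finType).

Fixpoint lcoef (t : lterm R X) (x : X) : R :=
  match t with
  | Var y => (x == y)%:R
  | Zero => 0
  | Opp t => - lcoef t x
  | Add t u => lcoef t x + lcoef u x
  | Act t a => a * lcoef t x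
  end.

Lemma teval_lcoef (N : lmodType R) (e : X -> N) t :
  teval (A := mod_struct N) e t = \sum_x lcoef t x *: e x.
Proof.
elim: t => /= [y||t ->|t -> u ->|t -> a].
- rewrite (bigD1 y) //= eqxx scale1r big1 ?addr0 // => x /negPf xy.
  by rewrite xy scale0r.
- by rewrite big1 // => x _; rewrite scale0r.
- by rewrite -sumrN; apply: eq_bigr => x _; rewrite scaleNr.
- by rewrite -big_split; apply: eq_bigr => x _; rewrite scalerDl.
- by rewrite scaler_sumr; apply: eq_bigr => x _; rewrite scalerA.
Qed.

Definition pos_rep (d : GammaPos R) : nz R := sval (cid (asboolW (valP d))).

Lemma pos_repP (d : GammaPos R) : val d = divval (pos_rep d).
Proof. by rewrite /pos_rep; case: cid. Qed.

(* The atom f says that atom_den f divides sum_x (atom_coef f x) x; an equation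
   is divisibility by 0. *)
Definition atom_coef (f : latom R (GammaPos R) X) (x : X) : R :=
  match f with
  | Eqn t u => lcoef t x - lcoef u x
  | Vpred _ t => lcoef t x
  end.

Definition atom_den (f : latom R (GammaPos R) X) : R :=
  if f is Vpred d _ then val (pos_rep d) else 0.

Lemma sat_atom_lin (N : lmodType R) (e : X -> N) f :
  sat_atom (A := mod_struct N) e f <->
  exists y : N, \sum_x atom_coef f x *: e x = atom_den f *: y.
Proof.
case: f => [t u|d t] /=.
  under eq_bigr do rewrite scalerBl.
  rewrite sumrB -!teval_lcoef; split=> [->|[y]].
    by exists 0; rewrite subrr scaler0.
  by rewrite scale0r => /subr0_eq.
rewrite -teval_lcoef; exact: svpred_divval (pos_repP d).
Qed.

End Linearization.

Lemma sat_conj_map (S D X : Type) (A : Lstruct S D) (e : X -> carrier A)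
    (I : finType) (f : I -> latom S D X) :
  sat_conj e [seq f i | i <- enum I] <-> forall i, sat_atom e (f i).
Proof.
suff h (s : seq I) : sat_conj e (map f s) <->
    forall i, i \in s -> sat_atom e (f i).
  by rewrite h; split=> fs i; [apply: fs; rewrite mem_enum|].
elim: s => [|i s IH] //=; rewrite IH; split.
  by case=> fi fs j; rewrite inE => /predU1P[->|/fs].
move=> fs; split=> [|j js]; apply: fs; first exact: mem_head.
by rewrite inE js orbT.
Qed.

Lemma sat_conj_tnth (S D X : Type) (A : Lstruct S D) (e : X -> carrier A)
    (c : lconj S D X) :
  sat_conj e c <-> forall k, sat_atom e (tnth (in_tuple c) k).
Proof. by rewrite -sat_conj_map map_tnth_enum. Qed.

(** * From a pp formula to a linear system *)

Section System.
Variables (R : idomainType) (n : nat) (phi : ppform R (GammaPos R) n).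
Local Notation r := (pp_bound phi).
Local Notation m := (size (pp_matrix phi)).
Let f (k : 'I_m) := tnth (in_tuple (pp_matrix phi)) k.

(* phi(z) as a linear system z A = w C in the bound variables of phi together
   with one witness of divisibility per atom; the zero columns make C square. *)
Definition sys_lhs : 'M[R]_(n, r + m) :=
  row_mx 0 (\matrix_(i, k) atom_coef (f k) (inl i)).

Definition sys_rhs : 'M[R]_(r + m) :=
  block_mx 0 (- \matrix_(j, k) atom_coef (f k) (inr j))
           0 (diag_mx (\row_k atom_den (f k))).

(** The vector [w] joins the bound variables and the witnesses. The first [r] columns read [0 = 0];
    each other column is an atom with its bound variables moved to the right. *)
Lemma sat_pp_system (N : lmodType R) (z : 'I_n -> N) :
  sat_pp (A := mod_struct N) z phi <->
  exists w : 'I_(r + m) -> N, vact z sys_lhs =1 vact w sys_rhs.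
Proof.
have E (w : 'I_(r + m) -> N) : vact z sys_lhs =1 vact w sys_rhs <->
    forall k, \sum_v atom_coef (f k) v *:
      (match v with inl i => z i | inr j => w (lshift m j) end) =
      atom_den (f k) *: w (rshift r k).
  have lhs0 j : vact z sys_lhs (lshift m j) = 0.
    by rewrite /vact big1 // => i _; rewrite row_mxEl mxE scale0r.
  have rhs0 j : vact w sys_rhs (lshift m j) = 0.
    rewrite /vact big1 // => i _; case: (split_ordP i) => i' ->.
      by rewrite block_mxEul mxE scale0r.
    by rewrite block_mxEdl mxE scale0r.
  have lhsE k : vact z sys_lhs (rshift r k) =
      \sum_i atom_coef (f k) (inl i) *: z i.
    by apply: eq_bigr => i _; rewrite row_mxEr mxE.
  have rhsE k : vact w sys_rhs (rshift r k) = atom_den (f k) *: w (rshift r k) -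
      \sum_j atom_coef (f k) (inr j) *: w (lshift m j).
    rewrite /vact big_split_ord /= addrC; congr (_ + _).
      under eq_bigr do rewrite block_mxEdr.
      by rewrite [LHS](vact_diag (fun k => w (rshift r k))) mxE.
    by rewrite -sumrN; apply: eq_bigr => j _; rewrite block_mxEur !mxE scaleNr.
  split=> h k.
    by rewrite big_sumType /= -lhsE h rhsE subrK.
  case: (split_ordP k) => j ->; first by rewrite lhs0 rhs0.
  by rewrite lhsE rhsE -h big_sumType /= addrK.
rewrite /sat_pp; split=> [[x]|[w /E ws]].
  move=> /sat_conj_tnth h.
  have /choice[y yP] k := (sat_atom_lin _ _).1 (h k).
  exists (fun i => match split i with inl j => x j | inr k => y k end).
  apply/E => k; rewrite (unsplitK (inr k)) -yP.
  by apply: eq_bigr => -[i|j] _ //; rewrite (unsplitK (inl j)).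
exists (fun j => w (lshift m j)).
apply/sat_conj_tnth => k.
by apply/sat_atom_lin; exists (w (rshift r k)); rewrite -ws.
Qed.

End System.

(** * From divisibility conditions back to atoms *)

Section LinearAtoms.
Variables (n : nat).

Definition lin_term S (c : 'I_n -> S) : lterm S 'I_n :=
  foldr (fun i t => Add (Act (Var i) (c i)) t) Zero (enum 'I_n).

(** [None] encodes divisibility by 0, an equation, as 0 has no class in [Gamma]. [S] and [D] are
    arbitrary so as to build the same atom over [B_M] and over [Q(B)]. *)
Definition lin_atom S D (c : 'I_n -> S) (d : option D) : latom S D 'I_n :=
  if d is Some d' then Vpred d' (lin_term c) else Eqn (lin_term c) Zero.

Lemma map_lin_term S S' (f : S -> S') (c : 'I_n -> S) :
  map_term f (lin_term c) = lin_term (f \o c).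
Proof. by rewrite /lin_term; elim: (enum 'I_n) => //= i s ->. Qed.

Lemma map_lin_atom S S' D D' (f : S -> S') (g : D -> D') (c : 'I_n -> S) d :
  map_atom f g (lin_atom c d) = lin_atom (f \o c) (omap g d).
Proof. by case: d => [d|] /=; rewrite map_lin_term. Qed.

Lemma teval_lin_term (R : idomainType) (N : lmodType R) (z : 'I_n -> N) c :
  teval (A := mod_struct N) z (lin_term c) = \sum_i c i *: z i.
Proof.
rewrite -big_enum /lin_term; elim: (enum 'I_n) => [|i s IH] /=.
  by rewrite big_nil.
by rewrite big_cons IH.
Qed.

Definition div_atom (R : idomainType) (c : 'I_n -> R) (d : R) :
    latom R (GammaPos R) 'I_n :=
  lin_atom c (omap (@GammaPos_divval R) (insub d)).

Definition frac_div_atom (B : idomainType) (c : 'I_n -> {fraction B}) d :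
    latom {fraction B} (Gamma B) 'I_n :=
  lin_atom c (omap (@gpi B) (insub d)).

Lemma sat_div_atom (R : idomainType) (N : lmodType R) (z : 'I_n -> N) c d :
  sat_atom (A := mod_struct N) z (div_atom c d) <->
  exists y, \sum_i c i *: z i = d *: y.
Proof.
rewrite /div_atom; case: insubP => [d1 _ <-|/negPn/eqP->] /=.
  by rewrite teval_lin_term; exact: svpred_GammaPos_divval.
rewrite teval_lin_term; split=> [->|[y]]; last by rewrite scale0r.
by exists 0; rewrite scale0r.
Qed.

End LinearAtoms.

(** * Reading formulas over [Q(B)] in [B_M] *)

Section Localize.
Variables (B : idomainType) (M : MSpec B).
Local Notation Q := {fraction B}.

(** [Gamma_loc] is given on quotients of elements of [B], so [x] is split into numerator and
    denominator and compared with [y / 1]. *)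
Lemma Gamma_loc_gpi (x : nz Q) (y : nz (loc M)) :
  val x = locval (val y) -> Gamma_loc M (gpi x) = divval y.
Proof.
move=> xy; pose a : nz B := NZ (gnum_subproof x).
pose b : nz B := NZ (denom_ratioP (repr (val x))).
have b0 : (val b)%:F != 0 by exact: tofrac_nz_subproof.
have -> : gpi x = (divval a / divval b)%g.
  rewrite -[RHS]/(Gmul _ (Ginv _)) Ginv_gpi Gmul_gpi.
  by congr gpi; apply: val_inj; rewrite /= -frac_repr.
have -> : divval y = (divval y / divval (nz1 (loc M)))%g.
  rewrite -[RHS]/(Gmul _ (Ginv _)) Ginv_gpi Gmul_gpi; apply/esym/eqP/gpiP.
  by exists 1; rewrite ?unitr1 //= tofrac1 invr1.
rewrite Gamma_loc_div; apply/divval_div_eq; exists 1; rewrite ?unitr1 //=.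
by apply: val_inj; rewrite /= !mulr1 -xy [val x]frac_repr divfK.
Qed.

Lemma frac_div_atom_reads n (c : 'I_n -> loc M) (d : loc M) :
  map_atom id (Gamma_loc M) (frac_div_atom (@locval B M \o c) (locval d)) =
  map_atom (@locval B M) val (div_atom c d).
Proof.
rewrite !map_lin_atom; congr lin_atom.
case: insubP => [x _ xd|]; case: insubP => [y _ yd|] //=.
- by congr Some; apply: Gamma_loc_gpi; rewrite yd.
(* The two mixed cases are void: [d] is zero in [B_M] iff it is zero in [Q(B)]. *)
- by move=> /negPn/eqP d0; have := valP x; rewrite /= xd d0 eqxx.
- move=> /negPn/eqP d0; have := valP y.
  by rewrite -(inj_eq val_inj) /= yd d0 eqxx.
Qed.

Local Notation mxval := (map_mx (val : loc M -> Q)).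

Lemma mxOver_in_loc m n (A : 'M[Q]_(m, n)) : A \is a mxOver (in_loc M) ->
  exists A' : 'M[loc M]_(m, n), A = mxval A'.
Proof.
move=> /mxOverP OA; exists (\matrix_(i, j) MkLoc (OA i j)).
by apply/matrixP=> i j; rewrite !mxE.
Qed.

Lemma map_tofrac m n (A : 'M[B]_(m, n)) :
  map_mx (@tofrac B) A = mxval (map_mx (@toloc B M) A).
Proof. by apply/matrixP=> i j; rewrite !mxE. Qed.

Lemma vact_restr (N : lmodType (loc M)) m n (z : 'I_m -> N) (A : 'M[B]_(m, n)) :
  vact (z : 'I_m -> restr N (@toloc B M)) A =
  vact z (map_mx (@toloc B M) A).
Proof.
by apply: funext => j; apply: eq_bigr => i _; rewrite mxE.
Qed.


(** For [t = (T, d)], this is the criterion of [solvable_diag], stated over [Q(B)] to serve all [M]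
    at once. *)
Definition diag_conj n s (A : 'M[Q]_(n, s)) (t : 'M[Q]_s * 'rV[Q]_s) :
    lconj Q (Gamma B) 'I_n :=
  [seq frac_div_atom (fun i => (A *m t.1) i j) (t.2 0 j) | j <- enum 'I_s].

(** The matrices lift from [Q(B)] to [B_M], as do the identities between them, so [solvable_diag]
    applies to the system of [phi] in any [B_M]-module. *)
Lemma equiv_diag_conj n (phi : ppform B (GammaPos B) n) t :
  diagonalizes (in_loc M) (map_mx (@tofrac B) (sys_rhs phi)) t.1 t.2 ->
  exists2 psi : lconj (loc M) (GammaPos (loc M)) 'I_n,
    reads_as (diag_conj (map_mx (@tofrac B) (sys_lhs phi)) t) psi &
    equiv_in_Mod phi psi.
Proof.
case: t => T d [_ [[/mxOver_in_loc[L ->] [_ /mxOver_in_loc[L' ->] eL]]]] /=.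
case=> /mxOver_in_loc[{}T ->] [_ /mxOver_in_loc[T' ->] eT].
rewrite !map_tofrac.
set C := map_mx _ (sys_rhs _); set A := map_mx _ (sys_lhs _).
have inj m k : injective (mxval : 'M[loc M]_(m, k) -> 'M_(m, k)).
  move=> X Y /matrixP XY; apply/matrixP=> i j; apply: val_inj.
  by have := XY i j; rewrite !mxE.
have LL' : L *m L' = 1%:M by apply: inj; rewrite map_mxM map_mx1.
have TT' : T *m T' = 1%:M by apply: inj; rewrite map_mxM map_mx1.
move=> eD; have {}eD : mxval (L *m C *m T) = diag_mx d by rewrite !map_mxM -eD.
(* The diagonal lies in [B_M] as a product of three matrices over [B_M]. *)
have Od : d \is a mxOver (in_loc M).
  apply/mxOverP=> i j; rewrite ord1; move/matrixP/(_ j j): eD.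
  by rewrite [LHS]mxE [RHS]mxE eqxx mulr1n => <-; apply: locP.
have [d' dE] := mxOver_in_loc Od.
have E : L *m C *m T = diag_mx d' by apply: inj; rewrite eD dE map_diag_mx.
rewrite dE; exists [seq div_atom (fun i => (A *m T) i j) (d' 0 j) |
                     j <- enum 'I_(_ + _)].
  rewrite /reads_as /map_conj /diag_conj -!map_comp; apply: eq_map => j /=.
  rewrite -frac_div_atom_reads; congr map_atom; congr frac_div_atom.
    apply: funext => i; rewrite -[LHS]/((mxval A *m mxval T) i j).
    by rewrite -map_mxM mxE.
  by rewrite mxE.
move=> N z; rewrite sat_pp_system sat_conj_map !vact_restr.
under eq_exists do rewrite vact_restr.
rewrite (solvable_diag _ _ LL' TT' E).
by split=> h j; [apply/sat_div_atom/h | have /sat_div_atom := h j].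
Qed.

End Localize.

(** * The order of the group of divisibility and the one-variable normal form *)

Lemma divval_leP (R : idomainType) (a b : nz R) :
  reflect (exists c, val b = c * val a) (divval a <= divval b)%O.
Proof.
have a0 := tofrac_nz_subproof a.
rewrite -[(_ <= _)%O]/(Gle _ _) Gle_gpi /=.
apply: (iffP (asboolP _)) => -[c e]; exists c.
  by apply/eqP; rewrite -tofrac_eq tofracM -e divfK.
by rewrite e tofracM mulfK.
Qed.

Lemma div_div_eq (F : fieldType) (a b c d e : F) :
  a != 0 -> b != 0 -> d != 0 ->
  (c / d / (a / b) == e) = (c * b == e * (a * d)).
Proof.
move=> a0 b0 d0; have ad0 : a * d != 0 by rewrite mulf_neq0.
by rewrite invf_div mulf_div [d * a]mulrC -(inj_eq (mulIf ad0)) divfK.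
Qed.

Lemma divval_div_leP (R : idomainType) (a b c d : nz R) :
  reflect (exists e, val c * val b = e * (val a * val d))
    (divval a / divval b <= divval c / divval d :> Gamma R)%g%O.
Proof.
have [a0 b0] := (tofrac_nz_subproof a, tofrac_nz_subproof b).
have d0 := tofrac_nz_subproof d.
rewrite -[(_ / _)%g in X in (X <= _)%O]/(Gmul _ (Ginv _)).
rewrite -[(_ / _)%g]/(Gmul _ (Ginv _)) !Ginv_gpi !Gmul_gpi.
rewrite -[(_ <= _)%O]/(Gle _ _) Gle_gpi /=.
apply: (iffP (asboolP _)) => -[e eE]; exists e; apply/eqP; move/eqP: eE.
  by rewrite (div_div_eq _ _ a0 b0 d0) -!tofracM tofrac_eq.
by rewrite (div_div_eq _ _ a0 b0 d0) -!tofracM tofrac_eq.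
Qed.

Section ValuationDomain.
Variable R : idomainType.
Hypothesis valR :
  forall a b : R, (exists c, b = c * a) \/ (exists c, a = c * b).

Lemma Gamma_total (g h : Gamma R) : (g <= h)%O || (h <= g)%O.
Proof.
rewrite [g]gnumdenE [h]gnumdenE; set a := gnum g; set b := gden g.
set c := gnum h; set d := gden h; apply/orP.
case: (valR (val a * val d) (val c * val b)) => -[e eE].
  by left; apply/divval_div_leP; exists e.
by right; apply/divval_div_leP; exists e.
Qed.

Lemma Gamma_ltNge (g h : Gamma R) : ~~ (g <= h)%O -> (h < g)%O.
Proof.
move=> gh; have := Gamma_total g h; rewrite (negPf gh) /= => hg.
by rewrite lt_leAnge hg gh.
Qed.

(* A pair x = (b, d) stands for the condition V_d(z b). *)
Implicit Types x y : nz R * nz R.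

Definition vsat (N : lmodType R) (z : N) x : Prop :=
  exists n, val x.1 *: z = val x.2 *: n.

Definition vratio x : Gamma R := (divval x.2 / divval x.1)%g.

Definition vimplies x y :=
  (divval x.1 <= divval y.1)%O && (vratio y <= vratio x)%O.

Definition vchain x y :=
  (divval y.1 < divval x.1)%O && (vratio y < vratio x)%O.

(** For x = (b, d) and y = (b', d') with [b' = c b], the inequality of ratios says that [d'] divides
    [c d]; and [z b = d n] gives [z b' = c d n]. *)
Lemma vimplies_vsat x y (N : lmodType R) (z : N) :
  vimplies x y -> vsat z x -> vsat z y.
Proof.
move=> /andP[/divval_leP[c yx1] /divval_div_leP[e eE]] [n xz].
have x10 : val x.1 != 0 := valP x.1.
have cE : c * val x.2 = val y.2 * e.
  apply: (mulIf x10).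
  by rewrite mulrAC -yx1 mulrC eE mulrA [e * _]mulrC.
by exists (e *: n); rewrite yx1 -scalerA xz !scalerA cE.
Qed.

Lemma vchain_trans : transitive vchain.
Proof.
move=> y x z /andP[xy1 xy2] /andP[yz1 yz2].
by rewrite /vchain (lt_trans yz1 xy1) (lt_trans yz2 xy2).
Qed.

(** Both coordinates are totally ordered. If neither condition implies the other, they compare
    strictly and in the same direction. *)
Lemma vchain_total x y :
  [|| vimplies x y, vimplies y x, vchain x y | vchain y x].
Proof.
rewrite /vimplies /vchain.
have [/= xy1|/Gamma_ltNge yx1] := boolP (divval x.1 <= divval y.1)%O.
  have [//|/Gamma_ltNge yx2] := boolP (vratio y <= vratio x)%O.
  rewrite (ltW yx2) andbT yx2 andbT.
  have [//|/Gamma_ltNge ->] := boolP (divval y.1 <= divval x.1)%O.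
  by rewrite /= orbT.
rewrite yx1 (ltW yx1) /=.
by have [//|/Gamma_ltNge ->] := boolP (vratio x <= vratio y)%O.
Qed.

(** If a member of [s] implies [x], then [x] is redundant. Otherwise the members comparable to [x]
    for [vchain] are kept on either side of it, and [x] implies all the others. *)
Lemma vchain_insert x s : pairwise vchain s ->
  exists2 s', pairwise vchain s' & forall (N : lmodType R) (z : N),
    (forall y, y \in x :: s -> vsat z y) <-> (forall y, y \in s' -> vsat z y).
Proof.
move=> chs; case: (boolP (has (vimplies^~ x) s)) => [/hasP[y ys yx]|/hasPn nx].
  exists s => // N z; split=> h w ws; first by apply: h; rewrite inE ws orbT.
  move: ws; rewrite inE => /predU1P[->|/h//].
  exact: vimplies_vsat yx (h _ ys).
pose s1 := [seq y <- s | vchain y x]; pose s2 := [seq y <- s | vchain x y].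
exists (s1 ++ x :: s2).
  rewrite pairwise_cat /= filter_all !pairwise_filter // !andbT.
  apply/allrelP => y w; rewrite mem_filter inE => /andP[yx _] /predU1P[-> //|].
  by rewrite mem_filter => /andP[xw _]; exact: vchain_trans yx xw.
move=> N z; split=> h y.
  rewrite mem_cat inE !mem_filter => ys; apply: h; rewrite inE.
  by case/or3P: ys => [/andP[_ ->]|->|/andP[_ ->]] //; rewrite orbT.
have xz : vsat z x by apply: h; rewrite mem_cat mem_head orbT.
rewrite inE => /predU1P[-> //|ys].
have := vchain_total x y; rewrite (negPf (nx _ ys)) /= => /or3P[xy|xy|yx].
- exact: vimplies_vsat xy xz.
- by apply: h; rewrite mem_cat inE !mem_filter xy ys !orbT.
- by apply: h; rewrite mem_cat inE !mem_filter yx ys.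
Qed.

(** Atoms are added one by one: an equation is merged into the single [z.a = 0], a divisibility
    condition is inserted into the chain. *)
Lemma one_var_chain (c : lconj R (GammaPos R) 'I_1) :
  exists (a : R) (s : seq (nz R * nz R)), pairwise vchain s /\
    forall (N : lmodType R) (z : 'I_1 -> N),
      sat_conj (A := mod_struct N) z c <->
      a *: z ord0 = 0 /\ (forall y, y \in s -> vsat (z ord0) y).
Proof.
elim: c => [|f c [a [s [chs IH]]]].
  (* The empty conjunction is [z.0 = 0] with an empty chain. *)
  by exists 0, [::]; split=> // N z; rewrite scale0r; split.
have satf (N : lmodType R) (z : 'I_1 -> N) :
    sat_atom (A := mod_struct N) z f <->
    exists n, atom_coef f ord0 *: z ord0 = atom_den f *: n.
  by rewrite sat_atom_lin; under eq_exists do rewrite big_ord1.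
(* An atom with zero coefficient always holds and is dropped, as the chain takes only nonzero
   coefficients. *)
have [c0|c0] := eqVneq (atom_coef f ord0) 0.
  exists a, s; split=> // N z; rewrite -IH /= satf c0; split=> [[]//|h].
  by split=> //; exists 0; rewrite scale0r scaler0.
have [d0|d0] := eqVneq (atom_den f) 0.
  have satf0 (N : lmodType R) (z : 'I_1 -> N) :
      sat_atom (A := mod_struct N) z f <-> atom_coef f ord0 *: z ord0 = 0.
    rewrite satf d0; split=> [[n ->]|->]; first by rewrite scale0r.
    by exists 0; rewrite scale0r.
  (* Of two equations, the one whose coefficient divides the other's implies it and is kept. *)
  case: (valR a (atom_coef f ord0)) => -[e eE].
    exists a, s; split=> // N z; rewrite /= satf0 IH eE -scalerA.
    by split=> [[]//|[-> ?]]; rewrite scaler0.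
  exists (atom_coef f ord0), s; split=> // N z; rewrite /= satf0 IH eE -scalerA.
  by split=> [[? []]//|[-> ?]]; rewrite scaler0.
have [s' chs' s'P] := vchain_insert (NZ c0, NZ d0) chs.
exists a, s'; split=> // N z; rewrite -s'P /= satf IH; split.
  by case=> fz [az sz]; split=> // y; rewrite inE => /predU1P[->|/sz].
case=> az sz; split; first exact: (sz _ (mem_head _ _)).
by split=> // y ys; apply: sz; rewrite inE ys orbT.
Qed.

Lemma one_var_normal_form (c : lconj R (GammaPos R) 'I_1) :
  exists (a : R) (n : nat) (b : 'I_n -> nz R) (delta : 'I_n -> GammaPos R),
    [/\ forall (N : lmodType R) (z : 'I_1 -> N),
          sat_conj (A := mod_struct N) z c <->
          sat_conj (A := mod_struct N) z (one_var_conj a b delta),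
        forall i j : 'I_n, (i < j)%N ->
          ((val (delta i) * (divval (b i))^-1)%g >
           (val (delta j) * (divval (b j))^-1)%g)%O
      & forall i j : 'I_n, (i < j)%N -> (divval (b i) > divval (b j))%O].
Proof.
have [a [s [chs cE]]] := one_var_chain c.
have lts (i j : 'I_(size s)) : (i < j)%N ->
    vchain (tnth (in_tuple s) i) (tnth (in_tuple s) j).
  pose x0 := tnth (in_tuple s) i.
  by move=> ij; rewrite !(tnth_nth x0); apply: (pairwiseP x0 chs); rewrite ?inE.
exists a, (size s), (fun i => (tnth (in_tuple s) i).1),
  (fun i => GammaPos_divval (tnth (in_tuple s) i).2); split.
- move=> N z; rewrite cE /= sat_conj_map; split=> -[az sz]; split=> //.
    by move=> i; apply/svpred_GammaPos_divval/sz/mem_tnth.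
  move=> y ys; have /tnthP[i ->] : y \in in_tuple s := ys.
  exact: (svpred_GammaPos_divval _ _).1 (sz i).
- by move=> i j /lts/andP[].
- by move=> i j /lts/andP[].
Qed.

End ValuationDomain.

(** * Passage to the localizations [B_M] of a Bezout domain *)

Lemma loc_valuation (B : idomainType) (bezoutB : bezout B) (M : MSpec B)
    (a b : loc M) : (exists c, b = c * a) \/ (exists c, a = c * b).
Proof.
have nz (x : loc M) : x != 0 -> locval x != 0.
  by move=> x0; rewrite -(inj_eq val_inj) in x0.
have [->|/nz a0] := eqVneq a 0; first by right; exists 0; rewrite mul0r.
have [->|/nz b0] := eqVneq b 0; first by left; exists 0; rewrite mul0r.
have /orP[h|h] := in_loc_valuation bezoutB M (val b / val a).
  by left; exists (MkLoc h); apply: val_inj; rewrite /= divfK.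
rewrite invf_div in h.
by right; exists (MkLoc h); apply: val_inj; rewrite /= divfK.
Qed.

Theorem theorem3p2 (B : idomainType) (bezoutB : bezout B) :
  (forall (n : nat) (phi : ppform B (GammaPos B) n),
     exists (K : finType) (C : K -> set (MSpec B))
            (chi : K -> lconj {fraction B} (Gamma B) 'I_n),
       [/\ forall k : K, constructible (C k),
           forall M : MSpec B, exists k : K, C k M
         & forall (k : K) (M : MSpec B), C k M ->
             exists2 psi : lconj (loc M) (GammaPos (loc M)) 'I_n,
               reads_as (chi k) psi & equiv_in_Mod phi psi])
  /\
  (forall (M : MSpec B) (phi : ppform B (GammaPos B) 1),
     exists (a : loc M) (n : nat) (b : 'I_n -> nz (loc M))
            (delta : 'I_n -> GammaPos (loc M)),
       [/\ equiv_in_Mod phi (one_var_conj a b delta),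
           forall i j : 'I_n, (i < j)%N ->
             ((val (delta i) * (divval (b i))^-1)%g >
              (val (delta j) * (divval (b j))^-1)%g)%O
         & forall i j : 'I_n, (i < j)%N ->
             (divval (b i) > divval (b j))%O]).
Proof.
have uniform n (phi : ppform B (GammaPos B) n) : piecewise (fun M chi =>
    exists2 psi : lconj (loc M) (GammaPos (loc M)) 'I_n,
      reads_as chi psi & equiv_in_Mod phi psi).
  apply: piecewise_map (piecewise_diagonalizes bezoutB _) _ => M t.
  exact: equiv_diag_conj.
split=> [n phi|M phi]; first exact: uniform.
(* A piece containing [M] supplies a conjunction over [B_M], a valuation domain, where the normal
   form applies. *)
have [K [C [chi [_ /(_ M)[k kM] /(_ k M kM)[psi _ psiE]]]]] := uniform _ phi.
have [a [n [b [delta [psi' lt1 lt2]]]]] :=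
  one_var_normal_form (@loc_valuation B bezoutB M) psi.
exists a, n, b, delta; split=> // N z; apply: iff_trans (psiE N z) (psi' N z).
Qed.
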